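(* Let $\mathfrak{C}$ and $\mathfrak{D}$ be abelian categories, and let $F\colon\mathfrak{C}\to\mathfrak{D}$ and $G\colon\mathfrak{D}\to\mathfrak{C}$ be additive functors forming an adjoint pair $(G,F)$ ($G$ left adjoint to $F$). Suppose that either $\mathfrak{D}$ has enough projective objects or $\mathfrak{C}$ has enough injective objects, that $G$ is left exact, and that $F$ is right exact, full and faithful. Let $\mathcal{X},\omega$ be classes of objects in $\mathfrak{C}$ and $m\in\mathbb{Z}_{\geq 0}$. If $(F(\mathcal{X}),F(\omega))$ is a Frobenius pair in $\mathfrak{D}$ which is left $[F(\omega)]^\wedge_m$-complete in $[F(\mathcal{X})]^{\perp_1}$, then $(\mathcal{X},\omega)$ is a Frobenius pair in $\mathfrak{C}$ which is left $\omega^\wedge_m$-complete in $\mathcal{X}^{\perp_1}$.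
   Context: Classes of objects are assumed closed under isomorphisms. $F(\mathcal X)$ denotes the essential image: all $D\in\mathfrak D$ isomorphic to $FX$ for some $X\in\mathcal X$ (similarly $F(\omega)$). $A\rightarrowtail B\twoheadrightarrow C$ denotes a short exact sequence. In an abelian category: $\mathcal{X}^{\perp_1}=\{N: \mathrm{Ext}^1(X,N)=0\ \forall X\in\mathcal X\}$ (Yoneda Ext). $\omega^\wedge_m$ is the class of objects $M$ having an exact sequence $0\to W_m\to\cdots\to W_0\to M\to 0$ with all $W_i\in\omega$. A (left) Frobenius pair $(\mathcal{X},\omega)$ in an abelian category: $\mathcal{X}$ is closed under extensions, kernels of epimorphisms between its objects, and direct summands; $\omega$ is closed under direct summands; $\mathrm{Ext}^i(X,W)=0$ for all $X\in\mathcal X$, $W\in\omega$, $i>0$; $\omega\subseteq\mathcal X$ and every $X\in\mathcal X$ admits a short exact sequence $X\rightarrowtail W\twoheadrightarrow X'$ with $W\in\omega$, $X'\in\mathcal X$. It is left $\omega^\wedge_m$-complete in $\mathcal X^{\perp_1}$ if for every $M\in\mathcal{X}^{\perp_1}$ there is a short exact sequence $K'\rightarrowtail L\twoheadrightarrow M$ with $L\in\omega^\wedge_m$ and $K'\in[\omega^\wedge_m]^{\perp_1}$. *)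

(* Defs.v *)
From mathcomp Require Import all_boot ssralg.
From Stdlib Require Import Relations.

Set Implicit Arguments.
Unset Strict Implicit.
Unset Printing Implicit Defensive.

Import GRing.Theory.
Local Open Scope ring_scope.

Declare Scope cat_scope.
Delimit Scope cat_scope with cat.
Local Open Scope cat_scope.

Record preadditive := Preadditive {
  obj :> Type;
  hom : obj -> obj -> zmodType;
  idm : forall A, hom A A;
  comp : forall A B C, hom B C -> hom A B -> hom A C;
  compA : forall A B C D (h : hom C D) (g : hom B C) (f : hom A B),
    comp h (comp g f) = comp (comp h g) f;
  comp1m : forall A B (f : hom A B), comp (idm B) f = f;
  compm1 : forall A B (f : hom A B), comp f (idm A) = f;
  compDl : forall A B C (g g' : hom B C) (f : hom A B),
    comp (g + g') f = comp g f + comp g' f;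
  compDr : forall A B C (g : hom B C) (f f' : hom A B),
    comp g (f + f') = comp g f + comp g f'
}.

Arguments hom {p} A B.
Arguments idm {p} A.
Arguments comp {p A B C} g f.

Notation "g ∘ f" := (comp g f) (at level 40, left associativity) : cat_scope.

Section Notions.
Variable C : preadditive.
Implicit Types A B S Z : C.

Definition mono A B (f : hom A B) : Prop :=
  forall Z (u v : hom Z A), f ∘ u = f ∘ v -> u = v.

Definition epi A B (f : hom A B) : Prop :=
  forall Z (u v : hom B Z), u ∘ f = v ∘ f -> u = v.

Definition is_iso A B (f : hom A B) : Prop :=
  exists g : hom B A, g ∘ f = idm A /\ f ∘ g = idm B.

Definition isomorphic A B : Prop := exists f : hom A B, is_iso f.

Definition is_zero_obj Z : Prop :=
  forall A, (forall f : hom A Z, f = 0) /\ (forall f : hom Z A, f = 0).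

Definition is_kernel K A B (k : hom K A) (f : hom A B) : Prop :=
  f ∘ k = 0 /\
  forall Z (u : hom Z A), f ∘ u = 0 -> exists! v : hom Z K, k ∘ v = u.

Definition is_cokernel A B Q (q : hom B Q) (f : hom A B) : Prop :=
  q ∘ f = 0 /\
  forall Z (u : hom B Z), u ∘ f = 0 -> exists! v : hom Q Z, v ∘ q = u.

Definition is_biproduct A B S
    (i1 : hom A S) (i2 : hom B S) (p1 : hom S A) (p2 : hom S B) : Prop :=
  [/\ p1 ∘ i1 = idm A, p2 ∘ i2 = idm B, p1 ∘ i2 = 0, p2 ∘ i1 = 0
    & i1 ∘ p1 + i2 ∘ p2 = idm S].

(* S is isomorphic to the direct sum of A and B. *)
Definition direct_sum A B S : Prop :=
  exists (i1 : hom A S) (i2 : hom B S) (p1 : hom S A) (p2 : hom S B),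
    is_biproduct i1 i2 p1 p2.

End Notions.

Record abelian := Abelian {
  acat :> preadditive;
  has_zero_obj : exists Z : acat, is_zero_obj Z;
  has_direct_sums : forall A B : acat, exists S, direct_sum A B S;
  has_kernels : forall (A B : acat) (f : hom A B),
    exists K (k : hom K A), is_kernel k f;
  has_cokernels : forall (A B : acat) (f : hom A B),
    exists Q (q : hom B Q), is_cokernel q f;
  mono_normal : forall (A B : acat) (f : hom A B), mono f ->
    exists Q (g : hom B Q), is_kernel f g;
  epi_normal : forall (A B : acat) (f : hom A B), epi f ->
    exists K (g : hom K A), is_cokernel f g
}.

Section Abelian.
Variable C : abelian.
Implicit Types (A B K L M N P W X Y : C) (Xc w : C -> Prop) (m n : nat).

(* A >-> B ->> P *)
Definition short_exact A B P (f : hom A B) (g : hom B P) : Prop :=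
  is_kernel f g /\ is_cokernel g f.

(* k being monic, f = k ∘ e is the epi-mono factorization of f, so its image
   is the kernel of g. *)
Definition exact A B P (f : hom A B) (g : hom B P) : Prop :=
  exists K (k : hom K B) (e : hom A K), [/\ is_kernel k g, epi e & f = k ∘ e].

Definition projective P : Prop :=
  forall A B (g : hom A B) (f : hom P B), epi g -> exists h, g ∘ h = f.

Definition injective_obj N : Prop :=
  forall A B (g : hom A B) (f : hom A N), mono g -> exists h, h ∘ g = f.

Definition enough_projectives : Prop :=
  forall A, exists P (p : hom P A), projective P /\ epi p.

Definition enough_injectives : Prop :=
  forall A, exists N (i : hom A N), injective_obj N /\ mono i.

(* An exact sequence  ... -> E_2 -> E_1 -> E_0 -> 0.  A bounded exact sequence
   is represented by taking E_i to be a zero object for large i. *)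
Record exact_seq := ExactSeq {
  es_obj :> nat -> C;
  es_d : forall i, hom (es_obj i.+1) (es_obj i);
  es_epi : epi (es_d 0);
  es_exact : forall i, exact (es_d i.+1) (es_d i)
}.

(* Exact sequences 0 -> W -> E_n -> ... -> E_1 -> X -> 0, i.e. n-fold extensions
   of X by W (for n > 0).  The end terms are E_0 and E_{n+1}, identified with X
   and W by specified isomorphisms, which avoids equalities between objects. *)
Record extension n X W := Extension {
  ext_seq :> exact_seq;
  ext_right : hom (ext_seq 0) X;
  ext_left : hom W (ext_seq n.+1);
  ext_right_iso : is_iso ext_right;
  ext_left_iso : is_iso ext_left;
  ext_bounded : forall i, (n.+1 < i)%N -> is_zero_obj (ext_seq i)
}.

(* Morphisms of n-fold extensions that are the identity on X and W. *)
Definition ext_morphism n X W (E E' : extension n X W) : Prop :=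
  exists f : forall i, hom (E i) (E' i),
    [/\ forall i, f i ∘ es_d E i = es_d E' i ∘ f i.+1,
        ext_right E' ∘ f 0 = ext_right E
      & f n.+1 ∘ ext_left E = ext_left E'].

Definition ext_equiv n X W : relation (extension n X W) :=
  clos_refl_sym_trans (extension n X W) (@ext_morphism n X W).

(* Ext^n(X, W) = 0 for the Yoneda Ext group, n > 0: its elements are the classes
   of n-fold extensions modulo ext_equiv, and the group is zero when there is
   exactly one class. *)
Definition Ext_zero n X W : Prop :=
  exists E0 : extension n X W, forall E, ext_equiv E0 E.

Definition iso_closed Xc : Prop :=
  forall A B, isomorphic A B -> Xc A -> Xc B.

Definition closed_extensions Xc : Prop :=
  forall A B P (f : hom A B) (g : hom B P),
    short_exact f g -> Xc A -> Xc P -> Xc B.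

Definition closed_epi_kernels Xc : Prop :=
  forall A B P (f : hom A B) (g : hom B P),
    short_exact f g -> Xc B -> Xc P -> Xc A.

Definition closed_summands Xc : Prop :=
  forall A B S, direct_sum A B S -> Xc S -> Xc A.

Record frobenius_pair Xc w : Prop := FrobeniusPair {
  fp_extensions : closed_extensions Xc;
  fp_epi_kernels : closed_epi_kernels Xc;
  fp_summands : closed_summands Xc;
  fp_w_summands : closed_summands w;
  fp_Ext : forall X W i, Xc X -> w W -> (0 < i)%N -> Ext_zero i X W;
  fp_w_sub : forall W, w W -> Xc W;
  fp_cogen : forall X, Xc X ->
    exists W X' (f : hom X W) (g : hom W X'), [/\ short_exact f g, w W & Xc X']
}.

Definition perp1 Xc : C -> Prop := fun N => forall X, Xc X -> Ext_zero 1 X N.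

(* w^wedge_m: there is an exact sequence 0 -> W_m -> ... -> W_0 -> M -> 0 with all
   W_i in w; here W_i is E_{i+1}. *)
Definition wedge m w : C -> Prop := fun M =>
  exists E : exact_seq,
    [/\ isomorphic (E 0) M,
        forall i, (i <= m)%N -> w (E i.+1)
      & forall i, (m < i)%N -> is_zero_obj (E i.+1)].

Definition left_wedge_complete m w Xc : Prop :=
  forall M, perp1 Xc M ->
    exists K L (k : hom K L) (p : hom L M),
      [/\ short_exact k p, wedge m w L & perp1 (wedge m w) K].

End Abelian.

Record additive_functor (C D : preadditive) := AdditiveFunctor {
  fobj :> C -> D;
  fmap : forall A B, {additive hom A B -> hom (fobj A) (fobj B)};
  fmap1 : forall A, fmap A A (idm A) = idm (fobj A);
  fmapM : forall A B P (g : hom B P) (f : hom A B),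
    fmap A P (g ∘ f) = fmap B P g ∘ fmap A B f
}.

Arguments fmap {C D} F {A B} : rename.

Section Functors.
Variables C D : abelian.
Implicit Type F : additive_functor C D.

Definition full F : Prop :=
  forall A B (g : hom (F A) (F B)), exists f : hom A B, fmap F f = g.

Definition faithful F : Prop :=
  forall A B (f g : hom A B), fmap F f = fmap F g -> f = g.

(* 0 -> A -> B -> P is exact iff A -> B is a kernel of B -> P. *)
Definition left_exact F : Prop :=
  forall A B P (f : hom A B) (g : hom B P),
    is_kernel f g -> is_kernel (fmap F f) (fmap F g).

Definition right_exact F : Prop :=
  forall A B P (f : hom A B) (g : hom B P),
    is_cokernel g f -> is_cokernel (fmap F g) (fmap F f).

Definition ess_image F (Xc : C -> Prop) : D -> Prop :=
  fun Y => exists X, Xc X /\ isomorphic Y (F X).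

End Functors.

Record adjunction (C D : abelian)
    (G : additive_functor D C) (F : additive_functor C D) := Adjunction {
  adj : forall (Y : D) (X : C), hom (G Y) X -> hom Y (F X);
  adj_bij : forall Y X, bijective (@adj Y X);
  adj_nat : forall Y Y' X X' (y : hom Y' Y) (x : hom X X') (h : hom (G Y) X),
    adj (x ∘ h ∘ fmap G y) = fmap F x ∘ adj h ∘ y
}.

(* Main.v *)
(** [F] is exact as a right exact right adjoint and [G] is exact as a left exact
left adjoint, while full faithfulness of [F] makes the counit [GF -> 1]
invertible.  Applying [F] and [G] to extensions, with unit and counit as the
comparison morphisms, identifies [Ext^n(X, W)] with [Ext^n(FX, FW)] for all [n].
The closure properties and the sequences are then moved between [C] and the
image of [F].  For completeness one also needs that the kernel [K'] of [L -> FM]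
comes from [C]: both [L], a cokernel of a map between objects of [F(w)], and
[FM] lie in the image of [F], which is closed under kernels and cokernels. *)

From mathcomp Require Import all_boot ssralg.
From Stdlib Require Import Relations IndefiniteDescription.
Require Import Defs.

Set Implicit Arguments.
Unset Strict Implicit.
Unset Printing Implicit Defensive.

Import GRing.Theory.
Local Open Scope ring_scope.
Local Open Scope cat_scope.

(** * Kernels, cokernels and isomorphisms in a preadditive category *)

Section Preadditive.
Variable C : preadditive.
Implicit Types A B P Q K Z : C.

Lemma comp0m A B P (f : hom A B) : (0 : hom B P) ∘ f = 0.
Proof. by apply: (addrI (0 ∘ f)); rewrite -compDl !addr0. Qed.

Lemma compm0 A B P (g : hom B P) : g ∘ (0 : hom A B) = 0.
Proof. by apply: (addrI (g ∘ 0)); rewrite -compDr !addr0. Qed.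

Lemma is_iso_id A : is_iso (idm A).
Proof. by exists (idm A); rewrite comp1m. Qed.

Lemma is_iso_comp A B P (g : hom B P) (f : hom A B) :
  is_iso g -> is_iso f -> is_iso (g ∘ f).
Proof.
move=> [g' [g'g gg']] [f' [f'f ff']]; exists (f' ∘ g'); split.
  by rewrite compA -(compA f') g'g compm1.
by rewrite compA -(compA g) ff' compm1.
Qed.

Lemma isomorphic_refl A : isomorphic A A.
Proof. by exists (idm A); apply: is_iso_id. Qed.

Lemma isomorphic_sym A B : isomorphic A B -> isomorphic B A.
Proof. by move=> [f [g [gf fg]]]; exists g, f. Qed.

Lemma isomorphic_trans B A P :
  isomorphic A B -> isomorphic B P -> isomorphic A P.
Proof. by move=> [f hf] [g hg]; exists (g ∘ f); apply: is_iso_comp. Qed.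

Lemma zero_obj_idm Z : idm Z = 0 -> is_zero_obj Z.
Proof.
move=> Z0 A; split=> f; first by rewrite -(comp1m f) Z0 comp0m.
by rewrite -(compm1 f) Z0 compm0.
Qed.

Lemma isomorphic_zero_obj Z Z' :
  is_zero_obj Z -> is_zero_obj Z' -> isomorphic Z Z'.
Proof.
move=> hZ hZ'; exists 0, 0; rewrite !comp0m.
by split; apply/esym; [apply: (proj1 (hZ _)) | apply: (proj1 (hZ' _))].
Qed.

Lemma kernel_mono K A B (k : hom K A) (f : hom A B) : is_kernel k f -> mono k.
Proof.
move=> [fk hk] Z u v kukv.
have [x [_ hx]] := hk _ (k ∘ v) ltac:(by rewrite compA fk comp0m).
by rewrite -(hx u kukv) -(hx v).
Qed.

Lemma cokernel_epi A B Q (q : hom B Q) (f : hom A B) : is_cokernel q f -> epi q.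
Proof.
move=> [qf hq] Z u v uqvq.
have [x [_ hx]] := hq _ (v ∘ q) ltac:(by rewrite -compA qf compm0).
by rewrite -(hx u uqvq) -(hx v).
Qed.

Lemma kernelP K A B (k : hom K A) (f : hom A B) :
    mono k -> f ∘ k = 0 ->
    (forall Z (u : hom Z A), f ∘ u = 0 -> exists v : hom Z K, k ∘ v = u) ->
  is_kernel k f.
Proof.
move=> mk fk hk; split=> // Z u /hk[v kv]; exists v; split=> // v' kv'.
by apply: mk; rewrite kv kv'.
Qed.

Lemma cokernelP A B Q (q : hom B Q) (f : hom A B) :
    epi q -> q ∘ f = 0 ->
    (forall Z (u : hom B Z), u ∘ f = 0 -> exists v : hom Q Z, v ∘ q = u) ->
  is_cokernel q f.
Proof.
move=> eq qf hq; split=> // Z u /hq[v vq]; exists v; split=> // v' vq'.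
by apply: eq; rewrite vq vq'.
Qed.

Lemma kernel_lift K A B (k : hom K A) (f : hom A B) Z (u : hom Z A) :
  is_kernel k f -> f ∘ u = 0 -> exists v : hom Z K, k ∘ v = u.
Proof. by move=> [_ hk] /hk[v [kv _]]; exists v. Qed.

Lemma cokernel_desc A B Q (q : hom B Q) (f : hom A B) Z (u : hom B Z) :
  is_cokernel q f -> u ∘ f = 0 -> exists v : hom Q Z, v ∘ q = u.
Proof. by move=> [_ hq] /hq[v [vq _]]; exists v. Qed.

Lemma kernel_uniq K K' A B (k : hom K A) (k' : hom K' A) (f : hom A B) :
  is_kernel k f -> is_kernel k' f -> isomorphic K K'.
Proof.
move=> hk hk'; have [a ka] := kernel_lift hk' (proj1 hk).
have [b kb] := kernel_lift hk (proj1 hk').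
exists a, b; split.
  by apply: (kernel_mono hk); rewrite compA kb ka compm1.
by apply: (kernel_mono hk'); rewrite compA ka kb compm1.
Qed.

Lemma cokernel_uniq A B Q Q' (q : hom B Q) (q' : hom B Q') (f : hom A B) :
  is_cokernel q f -> is_cokernel q' f -> isomorphic Q Q'.
Proof.
move=> hq hq'; have [a aq] := cokernel_desc hq (proj1 hq').
have [b bq] := cokernel_desc hq' (proj1 hq).
exists a, b; split.
  by apply: (cokernel_epi hq); rewrite -compA aq bq comp1m.
by apply: (cokernel_epi hq'); rewrite -compA bq aq comp1m.
Qed.

Lemma cokernel_comp_epi A A' B Q (q : hom B Q) (f : hom A B) (e : hom A' A) :
  epi e -> is_cokernel q f -> is_cokernel q (f ∘ e).
Proof.
move=> ee hq; apply: cokernelP; first exact: cokernel_epi hq.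
  by rewrite compA (proj1 hq) comp0m.
move=> Z u ufe; apply: (cokernel_desc hq); apply: ee.
by rewrite comp0m -compA.
Qed.

Lemma kernel_iso_arrow K A B A' B' (k : hom K A) (f : hom A B) (f' : hom A' B')
    (a : hom A A') (b : hom B B') :
  is_iso a -> is_iso b -> b ∘ f = f' ∘ a -> is_kernel k f ->
  is_kernel (a ∘ k) f'.
Proof.
move=> [a' [a'a aa']] [b' [b'b bb']] sq hk; apply: kernelP.
- move=> Z u v eqz; apply: (kernel_mono hk).
  by rewrite -(comp1m k) -a'a -!compA; congr (_ ∘ _); rewrite !compA.
- by rewrite compA -sq -compA (proj1 hk) compm0.
- move=> Z u f'u; have [v kv] : exists v, k ∘ v = a' ∘ u.
    apply: (kernel_lift hk); rewrite -(comp1m f) -b'b -(compA b') sq.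
    by rewrite -!compA (compA a) aa' comp1m f'u compm0.
  by exists v; rewrite -compA kv compA aa' comp1m.
Qed.

Lemma cokernel_iso_arrow A B A' B' Q (q : hom B' Q) (f : hom A B)
    (f' : hom A' B') (a : hom A A') (b : hom B B') :
  is_iso a -> is_iso b -> b ∘ f = f' ∘ a -> is_cokernel q f' ->
  is_cokernel (q ∘ b) f.
Proof.
move=> [a' [a'a aa']] [b' [b'b bb']] sq hq; apply: cokernelP.
- move=> Z u v eqz; apply: (cokernel_epi hq).
  by rewrite -(compm1 q) -bb' !compA; congr (_ ∘ _); rewrite -!compA.
- by rewrite -compA sq compA (proj1 hq) comp0m.
- move=> Z u uf; have [v vq] : exists v, v ∘ q = u ∘ b'.
    apply: (cokernel_desc hq); rewrite -(compm1 f') -aa' (compA f') -sq.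
    by rewrite !compA -(compA u) b'b compm1 uf comp0m.
  by exists v; rewrite compA vq -compA b'b compm1.
Qed.

Lemma kernel_iso_source K K' A B (k : hom K A) (f : hom A B) (i : hom K' K) :
  is_iso i -> is_kernel k f -> is_kernel (k ∘ i) f.
Proof.
move=> [i' [i'i ii']] hk; apply: kernelP.
- move=> Z u v; rewrite -!compA => /(kernel_mono hk) iuiv.
  by rewrite -(comp1m u) -(comp1m v) -i'i -!compA iuiv.
- by rewrite compA (proj1 hk) comp0m.
- move=> Z u /(kernel_lift hk)[v kv]; exists (i' ∘ v).
  by rewrite -compA (compA i) ii' comp1m.
Qed.

Lemma cokernel_iso_target A B Q Q' (q : hom B Q) (f : hom A B) (i : hom Q Q') :
  is_iso i -> is_cokernel q f -> is_cokernel (i ∘ q) f.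
Proof.
move=> [i' [i'i ii']] hq; apply: cokernelP.
- move=> Z u v; rewrite !compA => /(cokernel_epi hq) uivi.
  by rewrite -(compm1 u) -(compm1 v) -ii' !compA uivi.
- by rewrite -compA (proj1 hq) compm0.
- move=> Z u /(cokernel_desc hq)[v vq]; exists (v ∘ i').
  by rewrite compA -(compA v) i'i compm1.
Qed.

End Preadditive.

(** * Short exact and long exact sequences in an abelian category *)

Section Abelian.
Variable C : abelian.
Implicit Types A B K L P Q X W : C.

(** The epi [g] is a cokernel of some [h], and [h] factors through [k]; hence every map killing [k]
    kills [h] and descends along [g]. *)
Lemma cokernel_of_kernel K B P (k : hom K B) (g : hom B P) :
  epi g -> is_kernel k g -> is_cokernel g k.
Proof.
move=> eg hk; have [Z [h hg]] := epi_normal eg.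
have [v kv] := kernel_lift hk (proj1 hg).
apply: cokernelP => //; first exact: (proj1 hk).
by move=> T u uk; apply: (cokernel_desc hg); rewrite -kv compA uk comp0m.
Qed.

Lemma short_exact_epi K B P (k : hom K B) (g : hom B P) :
  epi g -> is_kernel k g -> short_exact k g.
Proof. by move=> eg hk; split=> //; apply: cokernel_of_kernel. Qed.

Lemma short_exact_iso A A' B P P' (f : hom A B) (g : hom B P)
    (a : hom A' A) (p : hom P P') :
  is_iso a -> is_iso p -> short_exact f g -> short_exact (f ∘ a) (p ∘ g).
Proof.
move=> ha hp [hf hg]; apply: short_exact_epi.
  exact: cokernel_epi (cokernel_iso_target hp hg).
rewrite -(comp1m (f ∘ a)).
apply: kernel_iso_arrow (is_iso_id _) hp _ (kernel_iso_source ha hf).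
by rewrite compm1.
Qed.

(** [es_d E 1] is an epi followed by the kernel of [es_d E 0], and precomposing with an epi does not
    change a cokernel. *)
Lemma exact_seq_cokernel (E : exact_seq C) : is_cokernel (es_d E 0) (es_d E 1).
Proof.
have [K [k [e [hk ee ->]]]] := es_exact E 0.
exact: cokernel_comp_epi ee (cokernel_of_kernel (@es_epi _ E) hk).
Qed.

End Abelian.

(** * What every additive functor preserves *)

Section Functor.
Variables (C D : abelian) (H : additive_functor C D).

Lemma fmap_iso (A B : C) (f : hom A B) : is_iso f -> is_iso (fmap H f).
Proof.
by move=> [g [gf fg]]; exists (fmap H g); rewrite -!fmapM gf fg !fmap1.
Qed.

Lemma fobj_isomorphic (A B : C) : isomorphic A B -> isomorphic (H A) (H B).
Proof. by move=> [f hf]; exists (fmap H f); apply: fmap_iso. Qed.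

Lemma fobj_zero_obj (Z : C) : is_zero_obj Z -> is_zero_obj (H Z).
Proof.
by move=> hZ; apply: zero_obj_idm; rewrite -fmap1 (proj1 (hZ Z) (idm Z)) raddf0.
Qed.

Lemma fobj_direct_sum (A B S : C) :
  direct_sum A B S -> direct_sum (H A) (H B) (H S).
Proof.
move=> [i1 [i2 [p1 [p2 [h11 h22 h12 h21 hS]]]]].
exists (fmap H i1), (fmap H i2), (fmap H p1), (fmap H p2).
by split; rewrite -!fmapM ?h11 ?h22 ?h12 ?h21 ?fmap1 ?raddf0 // -raddfD hS fmap1.
Qed.

End Functor.

(** * Exact functors acting on exact sequences and on Yoneda extensions *)

Section ExactFunctor.
Variables (C D : abelian) (H : additive_functor C D).
Hypotheses (H_lex : left_exact H) (H_rex : right_exact H).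

Lemma fmap_short_exact (A B P : C) (f : hom A B) (g : hom B P) :
  short_exact f g -> short_exact (fmap H f) (fmap H g).
Proof. by move=> [hf hg]; split; [apply: H_lex | apply: H_rex]. Qed.

Lemma fmap_epi (A B : C) (f : hom A B) : epi f -> epi (fmap H f).
Proof. by move=> /epi_normal[K [g /H_rex/cokernel_epi]]. Qed.

Lemma fmap_exact (A B P : C) (f : hom A B) (g : hom B P) :
  exact f g -> exact (fmap H f) (fmap H g).
Proof.
move=> [K [k [e [hk ee ->]]]]; exists (H K), (fmap H k), (fmap H e).
by split; [apply: H_lex | apply: fmap_epi | rewrite fmapM].
Qed.

Definition map_exact_seq (E : exact_seq C) : exact_seq D :=
  ExactSeq (fmap_epi (@es_epi _ E)) (fun i => fmap_exact (es_exact E i)).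

Lemma wedge_map m (w : C -> Prop) (w' : D -> Prop) M M' :
    (forall A, w A -> w' (H A)) -> isomorphic (H M) M' ->
  wedge m w M -> wedge m w' M'.
Proof.
move=> ww' HM [E [EM hw h0]]; exists (map_exact_seq E); split.
- exact: isomorphic_trans (fobj_isomorphic H EM) HM.
- by move=> i /hw/ww'.
- by move=> i /h0/(fobj_zero_obj H).
Qed.

Section MapExtension.
Variables (n : nat) (X W : C) (X' W' : D).
Variables (r : hom (H X) X') (l : hom W' (H W)).
Hypotheses (r_iso : is_iso r) (l_iso : is_iso l).

(** Composing with [r] and [l] adjusts the end terms, so that [G] can send extensions of [F A] by
    [F W] directly to extensions of [A] by [W]. *)
Definition map_extension (E : extension n X W) : extension n X' W' :=
  @Extension D n X' W' (map_exact_seq E)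
    (r ∘ fmap H (ext_right E)) (fmap H (ext_left E) ∘ l)
    (is_iso_comp r_iso (fmap_iso H (@ext_right_iso _ _ _ _ E)))
    (is_iso_comp (fmap_iso H (@ext_left_iso _ _ _ _ E)) l_iso)
    (fun i hi => fobj_zero_obj H (@ext_bounded _ _ _ _ E i hi)).

Lemma map_extension_equiv E E' :
  ext_equiv E E' -> ext_equiv (map_extension E) (map_extension E').
Proof.
elim=> {E E'} [E E' [f [fd fr fl]] | E | E E' _ IH | E E' E'' _ IH _ IH'].
- apply: rst_step; exists (fun i => fmap H (f i)); split=> /= [i||].
  + by rewrite -!fmapM fd.
  + by rewrite -compA -fmapM fr.
  + by rewrite compA -fmapM fl.
- exact: rst_refl.
- exact: rst_sym.
- exact: rst_trans IH IH'.
Qed.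

End MapExtension.
End ExactFunctor.

(** Since [psi] is a right inverse of [phi] up to equivalence, [phi] is surjective on classes, so a
    single class in the source leaves a single class in the target. *)
Lemma Ext_zero_transfer (C D : abelian) n (X W : C) (X' W' : D)
    (phi : extension n X W -> extension n X' W')
    (psi : extension n X' W' -> extension n X W) :
    (forall E E', ext_equiv E E' -> ext_equiv (phi E) (phi E')) ->
    (forall E, ext_equiv (phi (psi E)) E) ->
  Ext_zero n X W -> Ext_zero n X' W'.
Proof.
move=> hphi hpsi [E0 hE0]; exists (phi E0) => E.
exact: rst_trans (hphi _ _ (hE0 (psi E))) (hpsi E).
Qed.

(** With the identity as an exact functor, changing the end terms of an extension along isomorphisms
    is an instance of [map_extension]. *)
Definition id_fmap (C : preadditive) (A B : C) :
  {additive hom A B -> hom A B} := idfun.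

Definition id_functor (C : preadditive) : additive_functor C C :=
  @AdditiveFunctor C C id (@id_fmap C) (fun _ => erefl) (fun _ _ _ _ _ => erefl).

Lemma Ext_zero_iso (C : abelian) n (X X' W W' : C) :
  isomorphic X X' -> isomorphic W W' -> Ext_zero n X W -> Ext_zero n X' W'.
Proof.
move=> [r [r' [r'r rr']]] [l' [l [ll' l'l]]].
have lex : left_exact (id_functor C) by [].
have rex : right_exact (id_functor C) by [].
have r_iso : @is_iso C (id_functor C X) X' r by exists r'.
have r'_iso : @is_iso C (id_functor C X') X r' by exists r.
have l_iso : @is_iso C W' (id_functor C W) l by exists l'.
have l'_iso : @is_iso C W (id_functor C W') l' by exists l.
apply: (Ext_zero_transfer (phi := map_extension lex rex r_iso l_iso)
                          (psi := map_extension lex rex r'_iso l'_iso)).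
  exact: map_extension_equiv.
(* The round trip keeps all objects and differentials of [E]; at the two ends it composes with
   mutually inverse isomorphisms, which cancel. *)
move=> E; apply: rst_step; exists (fun i => idm (E i)); split=> /= [i||].
- by rewrite comp1m compm1.
- by rewrite compm1 compA rr' comp1m.
- by rewrite comp1m -compA l'l compm1.
Qed.

(** * The adjunction: exactness, unit and counit *)

Section Reflective.
Variables (C D : abelian).
Variables (F : additive_functor C D) (G : additive_functor D C).
Variable GF_adj : adjunction G F.

Let adj_ Y X (h : hom (G Y) X) : hom Y (F X) := adj GF_adj h.

Lemma adj_inj Y X : injective (@adj_ Y X).
Proof. exact: bij_inj (adj_bij GF_adj Y X). Qed.

Lemma adj_surj Y X (u : hom Y (F X)) : exists h, adj_ h = u.
Proof. by have [g _ gK] := adj_bij GF_adj Y X; exists (g u); apply: gK. Qed.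

Lemma adj_postcomp Y X X' (x : hom X X') (h : hom (G Y) X) :
  adj_ (x ∘ h) = fmap F x ∘ adj_ h.
Proof. by have := adj_nat GF_adj (idm Y) x h; rewrite fmap1 !compm1. Qed.

Lemma adj_precomp Y Y' X (y : hom Y' Y) (h : hom (G Y) X) :
  adj_ (h ∘ fmap G y) = adj_ h ∘ y.
Proof. by have := adj_nat GF_adj y (idm X) h; rewrite fmap1 !comp1m. Qed.

(** The bijection is assumed natural but not additive; naturality at the zero endomorphism of [X]
    suffices. *)
Lemma adj0 Y X : adj_ (0 : hom (G Y) X) = 0.
Proof.
have := adj_postcomp (0 : hom X X) (0 : hom (G Y) X).
by rewrite raddf0 !comp0m.
Qed.

(** Maps from [Z] to [F A] correspond to maps from [G Z] to [A], so the universal property of the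
    kernel is carried across [adj_]. *)
Lemma right_adjoint_left_exact : left_exact F.
Proof.
move=> A B P f g hf; apply: kernelP.
- move=> Z u v; have [u' <-] := adj_surj u; have [v' <-] := adj_surj v.
  by rewrite -!adj_postcomp => /adj_inj/(kernel_mono hf) ->.
- by rewrite -fmapM (proj1 hf) raddf0.
- move=> Z u; have [u' <-] := adj_surj u.
  rewrite -adj_postcomp -[0]adj0 => /adj_inj/(kernel_lift hf)[v fv].
  by exists (adj_ v); rewrite -adj_postcomp fv.
Qed.

Lemma left_adjoint_right_exact : right_exact G.
Proof.
move=> A B P f g hg; apply: cokernelP.
- move=> Z u v uv; apply: adj_inj; apply: (cokernel_epi hg).
  by rewrite -!adj_precomp uv.
- by rewrite -fmapM (proj1 hg) raddf0.
- move=> Z u uf; have [v vg] : exists v, v ∘ g = adj_ u.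
    by apply: (cokernel_desc hg); rewrite -adj_precomp uf adj0.
  have [v' v'E] := adj_surj v; exists v'; apply: adj_inj.
  by rewrite adj_precomp v'E.
Qed.

Let unit Y : hom Y (F (G Y)) := adj_ (idm (G Y)).

Lemma unit_nat Y Y' (y : hom Y Y') :
  unit Y' ∘ y = fmap F (fmap G y) ∘ unit Y.
Proof. by rewrite -adj_precomp -adj_postcomp comp1m compm1. Qed.

(* The adjunction only asserts that [adj] is bijective, so the counit is
   obtained by choice. *)
Definition counit_sig A := constructive_indefinite_description _
  (adj_surj (idm (F A))).
Definition counit A : hom (G (F A)) A := proj1_sig (counit_sig A).

Lemma adj_counit A : adj_ (counit A) = idm (F A).
Proof. exact: proj2_sig (counit_sig A). Qed.

Lemma counit_nat A B (f : hom A B) :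
  counit B ∘ fmap G (fmap F f) = f ∘ counit A.
Proof.
by apply: adj_inj; rewrite adj_precomp adj_postcomp !adj_counit comp1m compm1.
Qed.

(** One of the two triangle identities. *)
Lemma fmap_counit_unit A : fmap F (counit A) ∘ unit (F A) = idm (F A).
Proof. by rewrite -adj_postcomp compm1 adj_counit. Qed.

(** * Consequences of full faithfulness *)

Hypotheses (F_full : full F) (F_faithful : faithful F).

Lemma isomorphic_reflect (A B : C) : isomorphic (F A) (F B) -> isomorphic A B.
Proof.
move=> [f [g []]]; have [f' <-] := F_full f; have [g' <-] := F_full g.
by rewrite -!fmapM -!fmap1 => /F_faithful gf /F_faithful fg; exists f', g'.
Qed.

Lemma ess_imageE (Xc : C -> Prop) (A : C) :
  iso_closed Xc -> ess_image F Xc (F A) <-> Xc A.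
Proof.
move=> Xc_iso; split=> [[B [XB /isomorphic_reflect AB]] | XA].
  exact: Xc_iso (isomorphic_sym AB) XB.
by exists A; split=> //; apply: isomorphic_refl.
Qed.

(** Fullness lifts the unit at [F A] to a map [s] from [A] to [G (F A)]. It inverts the counit: one
    composite is checked under [adj_], the other under [F] by the triangle identity. *)
Lemma counit_iso A : is_iso (counit A).
Proof.
have [s sE] := F_full (unit (F A)); exists s; split.
  by apply: adj_inj; rewrite adj_postcomp adj_counit compm1.
by apply: F_faithful; rewrite fmapM sE -adj_postcomp compm1 fmap1 adj_counit.
Qed.

Lemma counit_isomorphic (A : C) : isomorphic (G (F A)) A.
Proof. by exists (counit A); apply: counit_iso. Qed.

Lemma ess_image_reflect (Xc : C -> Prop) Y :
  iso_closed Xc -> ess_image F Xc Y -> Xc (G Y).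
Proof.
move=> Xc_iso [A [XA YA]]; apply: Xc_iso XA.
apply/isomorphic_sym; apply: isomorphic_trans (counit_isomorphic A).
exact: fobj_isomorphic.
Qed.

(** * Comparison of Yoneda Ext in the two categories *)

Hypotheses (G_lex : left_exact G) (F_rex : right_exact F).
Let F_lex : left_exact F := right_adjoint_left_exact.
Let G_rex : right_exact G := left_adjoint_right_exact.

(** Termwise, the counit is a morphism of extensions from [phi (psi E)] to [E], and the unit one
    from [E] to [psi (phi E)]. The unit may fail to be invertible at the middle terms, but
    equivalence of extensions only asks for a chain of morphisms. *)
Lemma Ext_zero_embed n (A W : C) : Ext_zero n (F A) (F W) <-> Ext_zero n A W.
Proof.
have [s [sW Ws]] := counit_iso W.
have s_iso : is_iso s by exists (counit W).
(* Composing the triangle identity with [fmap F s] gives this; it makes the left ends agree when the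
   unit is used as a morphism of extensions. *)
have sE : fmap F s = unit (F W).
  rewrite -(compm1 (fmap F s)) -(fmap_counit_unit W) compA -fmapM sW.
  by rewrite fmap1 comp1m.
pose phi : extension n (F A) (F W) -> extension n A W :=
  map_extension G_lex G_rex (counit_iso A) s_iso.
pose psi : extension n A W -> extension n (F A) (F W) :=
  map_extension F_lex F_rex (is_iso_id _) (is_iso_id _).
split.
- apply: (Ext_zero_transfer (phi := phi) (psi := psi)).
    exact: map_extension_equiv.
  move=> E; apply: rst_step; exists (fun i => counit (E i)); split=> /= [i||].
  + exact: counit_nat.
  + by rewrite comp1m counit_nat.
  + by rewrite compm1 compA counit_nat -compA Ws compm1.
- apply: (Ext_zero_transfer (phi := psi) (psi := phi)).
    exact: map_extension_equiv.
  move=> E; apply: rst_sym; apply: rst_step.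
  exists (fun i => unit (E i)); split=> /= [i||].
  + exact: unit_nat.
  + by rewrite comp1m fmapM -compA -unit_nat compA fmap_counit_unit comp1m.
  + by rewrite compm1 fmapM sE unit_nat.
Qed.

(** * The image of [F] and its closure properties *)

Let in_image : D -> Prop := ess_image F (fun=> True).

Lemma in_image_isomorphic Y Y' : isomorphic Y Y' -> in_image Y -> in_image Y'.
Proof.
move=> YY' [A [_ YA]]; exists A; split=> //.
exact: isomorphic_trans (isomorphic_sym YY') YA.
Qed.

(** Fullness replaces an arrow between objects of the image by some [fmap F f']; the kernel and
    cokernel of [f'] taken in [C] are then preserved by the exact functor [F]. *)
Lemma arrow_in_image Y Y' (f : hom Y Y') : in_image Y -> in_image Y' ->
  exists A A' (f' : hom A A') (a : hom Y (F A)) (a' : hom Y' (F A')),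
    [/\ is_iso a, is_iso a' & a' ∘ f = fmap F f' ∘ a].
Proof.
move=> [A [_ [a [b [ba ab]]]]] [A' [_ [a' ha']]].
have [f' f'E] := F_full (a' ∘ f ∘ b); exists A, A', f', a, a'; split=> //.
  by exists b.
by rewrite f'E -compA ba compm1.
Qed.

Lemma in_image_kernel K Y Y' (k : hom K Y) (f : hom Y Y') :
  is_kernel k f -> in_image Y -> in_image Y' -> in_image K.
Proof.
move=> hk /(arrow_in_image f) h /h{h}[A [A' [f' [a [a' [ha ha' sq]]]]]].
have [L [l hl]] := has_kernels f'; exists L; split=> //.
exact: kernel_uniq (kernel_iso_arrow ha ha' sq hk) (F_lex hl).
Qed.

Lemma in_image_cokernel Q Y Y' (q : hom Y' Q) (f : hom Y Y') :
  is_cokernel q f -> in_image Y -> in_image Y' -> in_image Q.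
Proof.
move=> hq /(arrow_in_image f) h /h{h}[A [A' [f' [a [a' [ha ha' sq]]]]]].
have [L [l hl]] := has_cokernels f'; exists L; split=> //.
exact: cokernel_uniq hq (cokernel_iso_arrow ha ha' sq (F_rex hl)).
Qed.

Lemma in_image_zero Y : is_zero_obj Y -> in_image Y.
Proof.
move=> hY; have [Z hZ] := has_zero_obj C; exists Z; split=> //.
by apply: isomorphic_zero_obj hY _; apply: fobj_zero_obj.
Qed.

(** Up to isomorphism, [M] is the cokernel of the differential from [E 2] to [E 1], so it suffices
    that these two terms lie in the image. *)
Lemma wedge_in_image m (w : C -> Prop) M :
  wedge m (ess_image F w) M -> in_image M.
Proof.
move=> [E [EM hw h0]].
(* Terms beyond the length of the sequence are zero objects rather than members of [F(w)]; for
   [m = 0] this already concerns [E 2]. *)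
have hE i : in_image (E i.+1).
  by case: (leqP i m) => [/hw[A [_ ?]] | /h0/in_image_zero //]; exists A.
exact: in_image_isomorphic EM (in_image_cokernel (exact_seq_cokernel E) _ _).
Qed.

(** The chain is [Y], [F A], [F (G (F A))], [F (G Y)], with the counit at [A] in the middle. *)
Lemma isomorphic_reflection Y : in_image Y -> isomorphic Y (F (G Y)).
Proof.
move=> [A [_ YA]]; apply: (isomorphic_trans YA).
apply: isomorphic_trans (fobj_isomorphic F (isomorphic_sym _)) _.
  exact: counit_isomorphic.
by do 2!apply: fobj_isomorphic; apply: isomorphic_sym.
Qed.

(** * Reflecting Frobenius pairs and completeness *)

Lemma frobenius_pair_reflect (X w : C -> Prop) :
  iso_closed X -> iso_closed w ->
  frobenius_pair (ess_image F X) (ess_image F w) -> frobenius_pair X w.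
Proof.
move=> X_iso w_iso frob.
have XE A := ess_imageE A X_iso; have wE A := ess_imageE A w_iso.
have F_se := fmap_short_exact F_lex F_rex.
split.
- move=> A B P f g /F_se hfg /XE XA /XE XP; apply/XE.
  exact: fp_extensions frob _ _ _ _ _ hfg XA XP.
- move=> A B P f g /F_se hfg /XE XB /XE XP; apply/XE.
  exact: fp_epi_kernels frob _ _ _ _ _ hfg XB XP.
- move=> A B S /(fobj_direct_sum F) hS /XE XS; apply/XE.
  exact: fp_summands frob _ _ _ hS XS.
- move=> A B S /(fobj_direct_sum F) hS /wE wS; apply/wE.
  exact: fp_w_summands frob _ _ _ hS wS.
- move=> A W i /XE XA /wE wW i_gt0; apply/Ext_zero_embed.
  exact: fp_Ext frob _ _ _ XA wW i_gt0.
- by move=> W /wE /(fp_w_sub frob)/XE.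
- move=> A /XE /(fp_cogen frob)[W [A' [f [g [hfg wW XA']]]]].
  have [s [sA As]] := counit_iso A.
  (* The sequence starting at [F A] is brought back by [G]; the inverse [s] of the counit replaces
     its first term [G (F A)] by [A]. *)
  exists (G W), (G A'), (fmap G f ∘ s), (idm _ ∘ fmap G g).
  split; [|exact: ess_image_reflect wW|exact: ess_image_reflect XA'].
  apply: short_exact_iso (is_iso_id _) _; first by exists (counit A).
  exact: fmap_short_exact.
Qed.

Lemma left_wedge_complete_reflect m (X w : C -> Prop) : iso_closed w ->
  left_wedge_complete m (ess_image F w) (ess_image F X) ->
  left_wedge_complete m w X.
Proof.
move=> w_iso complete M hM.
have [|K [L [k [p [hkp hL hK]]]]] := complete (F M).
  (* [F M] is orthogonal to [F(X)]: an object [Y] there may be replaced by [F A], and vanishing of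
     Ext for [A] and [M] passes to [F A] and [F M]. *)
  move=> Y [A [XA YA]].
  apply: Ext_zero_iso (isomorphic_sym YA) (isomorphic_refl _) _.
  by apply/Ext_zero_embed; apply: hM.
exists (G K), (G L), (fmap G k ∘ idm _), (counit M ∘ fmap G p); split.
- apply: short_exact_iso (is_iso_id _) (counit_iso M) _.
  exact: fmap_short_exact.
- apply: (wedge_map G_lex G_rex _ (isomorphic_refl _) hL).
  by move=> A; apply: ess_image_reflect.
(* Comparing Ext along [F] leads to [F (G K)], whereas [hK] concerns [K]; the two are isomorphic
   once [K], a kernel of a map from [L] to [F M], is in the image. *)
- have K_in : in_image K.
    apply: in_image_kernel (proj1 hkp) (wedge_in_image hL) _.
    by exists M; split=> //; apply: isomorphic_refl.
  move=> N hN; apply/Ext_zero_embed.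
  apply: Ext_zero_iso (isomorphic_refl _) (isomorphic_reflection K_in) _.
  (* [F] turns the finite resolution of [N] by [w] into one of [F N] by [F(w)]. *)
  apply: hK; apply: (wedge_map F_lex F_rex _ (isomorphic_refl _) hN).
  by move=> A wA; exists A; split=> //; apply: isomorphic_refl.
Qed.

End Reflective.

Theorem proposition5p10 (C D : abelian)
    (F : additive_functor C D) (G : additive_functor D C)
    (GF_adj : adjunction G F)
    (enough : enough_projectives D \/ enough_injectives C)
    (G_lex : left_exact G)
    (F_rex : right_exact F) (F_full : full F) (F_faithful : faithful F)
    (X w : C -> Prop) (X_iso : iso_closed X) (w_iso : iso_closed w) (m : nat)
    (FX_frob : frobenius_pair (ess_image F X) (ess_image F w))
    (FX_complete : left_wedge_complete m (ess_image F w) (ess_image F X)) :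
  frobenius_pair X w /\ left_wedge_complete m w X.
Proof.
split; first exact: (frobenius_pair_reflect GF_adj).
exact: (left_wedge_complete_reflect GF_adj).
Qed.
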